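(* In an irreducible Markov renewal process on a finite state space $S=\{1,\dots,m\}$, with embedded chain transition matrix $P$ and stationary probability vector $\pi$ of the embedded chain, mean sojourn time vector $\mu$, $\lambda=\pi^T\mu>0$, mean first passage times $m_{ij}$, and stationary distribution $\{\varpi_j\}$ of the associated semi-Markov process, the mixture $k_i^{(2)}=\sum_{j\in S}\varpi_jm_{ij}$ is independent of the initial state $i$ if and only if the mean sojourn times $\mu_j$ are the same for all states $j$. When this condition is satisfied, i.e. $\mu=\lambda e$, one has $k_i^{(2)}=K_C^{(2)}$ for all $i$, where $$K_C^{(2)}=\lambda\left[1+\mathrm{tr}(G)-\mathrm{tr}(G\Pi)\right]=\lambda\,\mathrm{tr}(Z)=\lambda\left[1+\mathrm{tr}(A^{\#})\right]=\lambda\left[1+\mathrm{tr}(\widetilde G)\right]-\frac{1}{u^Te}=K_C^{(1)},$$ for any g-inverse $G$ of $I-P$, $Z=[I-P+\Pi]^{-1}$, $A^{\#}$ the group inverse of $I-P$, and $\widetilde G=[I-P+\mu u^T]^{-1}$ for any $u\in\mathbb{R}^m$ with $u^Te\neq0$; here $K_C^{(1)}$ denotes the common value (under $\mu=\lambda e$) of $\sum_{j\in S}\pi_jm_{ij}$, $i\in S$.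
   Context: A Markov renewal process (MRP) $\{(X_n,T_n),n\ge 0\}$ on $S=\{1,\dots,m\}$ has $T_0=0\le T_1\le T_2\le\cdots$ and semi-Markov kernel $Q_{ij}(t)=P\{X_{n+1}=j,\ T_{n+1}-T_n\le t\mid X_n=i\}$ (Markov property: conditionally on the past up to step $n$, the law of $(X_{n+1},T_{n+1}-T_n)$ depends only on $X_n$, through this kernel). The embedded Markov chain $\{X_n\}$ has transition matrix $P=[p_{ij}]$, $p_{ij}=Q_{ij}(+\infty)$; the MRP is called irreducible when $P$ is irreducible. Put $\mu_{ij}=\int_0^\infty t\,dQ_{ij}(t)$, assumed finite, and $\mu_i=\sum_k\mu_{ik}$, the mean sojourn time on a visit to state $i$; $\mu=(\mu_1,\dots,\mu_m)^T$. $\pi=(\pi_1,\dots,\pi_m)^T$ is the unique vector with $\pi^TP=\pi^T$, $\pi^Te=1$, where $e=(1,\dots,1)^T$; $\Pi=e\pi^T$. $\lambda=\pi^T\mu$, assumed positive. The associated semi-Markov process is $X(t)=X_n$ for $T_n\le t<T_{n+1}$; its stationary probability vector $\varpi$ is given by $\varpi_j=\pi_j\mu_j/\lambda$. The mean first passage time is $m_{ij}=E[T_{ij}\mid X_0=i]$, where $T_{ij}=T_n$ with $n=\min\{r\ge1: X_r=j\}$ given $X_0=i$ (the return time if $i=j$); these are all finite. A g-inverse (one-condition generalized inverse) of $I-P$ is any matrix $G$ with $(I-P)G(I-P)=I-P$. The group inverse $A^{\#}$ of $A=I-P$ is the unique matrix with $AA^{\#}A=A$, $A^{\#}AA^{\#}=A^{\#}$,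 $AA^{\#}=A^{\#}A$; it equals $Z-\Pi$. *)

(* Defs.v *)
From HB Require Import structures.
From mathcomp Require Import all_boot all_order all_algebra.
From mathcomp Require Import all_classical all_reals all_analysis.

Set Implicit Arguments.
Unset Strict Implicit.
Unset Printing Implicit Defensive.

Import Order.TTheory GRing.Theory Num.Theory.
Import numFieldNormedType.Exports.

Local Open Scope classical_set_scope.
Local Open Scope ring_scope.

(* The sigma-algebra generated by X_0, T_0, ..., X_n, T_n. *)
Definition past (R : realType) (d : measure_display) (Omega : measurableType d)
    (m : nat) (X : nat -> Omega -> 'I_m) (T : nat -> Omega -> R) (n : nat) :
    set (set Omega) :=
  <<s [set B | exists2 k, (k <= n)%N &
        (exists i, B = X k @^-1` [set i]) \/
        (exists2 C : set R, measurable C & B = T k @^-1` C)] >>.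

(* The last field says
     P(X_{n+1} = j, T_{n+1} - T_n <= t | X_0, T_0, ..., X_n, T_n) = Q_{X_n j}(t),
   in the integrated form that defines the conditional probability, on the
   part {X_n = i} of each event A of the past. *)
Record markov_renewal_process (R : realType) (d : measure_display)
    (Omega : measurableType d) (m : nat) (P : probability Omega R)
    (Q : 'I_m -> 'I_m -> cumulative R R)
    (X : nat -> Omega -> 'I_m) (T : nat -> Omega -> R) : Prop := {
  mrp_measurable_state : forall n i, measurable (X n @^-1` [set i]) ;
  mrp_measurable_time : forall n, measurable_fun setT (T n) ;
  mrp_time0 : forall w, T 0%N w = 0 ;
  mrp_time_nondecreasing : forall n w, T n w <= T n.+1 w ;
  mrp_markov : forall n A, past X T n A -> forall i j t,
    P (A `&` [set w | [/\ X n w = i, X n.+1 w = j & T n.+1 w - T n w <= t]])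
    = (P (A `&` [set w | X n w = i]) * (Q i j t)%:E)%E }.

Definition embedded_matrix (R : realType) (m : nat)
    (Q : 'I_m -> 'I_m -> cumulative R R) : 'M[R]_m :=
  \matrix_(i, j) lim (Q i j t @[t --> +oo]).

Definition irreducible_matrix (R : realType) (m : nat) (P : 'M[R]_m) : Prop :=
  forall i j, exists n : nat, 0 < (P ^+ n) i j.

(* mu_ij, the integral of t dQ_ij(t) over [0, +oo[ *)
Definition mean_jump_time (R : realType) (m : nat)
    (Q : 'I_m -> 'I_m -> cumulative R R) (i j : 'I_m) : \bar R :=
  (\int[lebesgue_stieltjes_measure (Q i j)]_(t in `[0%R, +oo[) t%:E)%E.

(* To be used under finiteness of the [mean_jump_time Q i k]. *)
Definition mean_sojourn (R : realType) (m : nat)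
    (Q : 'I_m -> 'I_m -> cumulative R R) : 'cV[R]_m :=
  \col_i \sum_k fine (mean_jump_time Q i k).

Definition ones (R : realType) (m : nat) : 'cV[R]_m := const_mx 1.

Definition stationary_vector (R : realType) (m : nat) (P : 'M[R]_m)
    (pi : 'cV[R]_m) : Prop :=
  pi^T *m P = pi^T /\ (pi^T *m ones R m) 0 0 = 1.

(* T_n for the least n >= 1 with X_n = j; +oo if j is never visited after
   time 0. *)
Definition first_passage (R : realType) (d : measure_display)
    (Omega : measurableType d) (m : nat) (X : nat -> Omega -> 'I_m)
    (T : nat -> Omega -> R) (j : 'I_m) (w : Omega) : \bar R :=
  match pselect (exists r, (0 < r)%N && (X r w == j)) with
  | left visit => (T (ex_minn visit) w)%:E
  | right _ => +oo%E
  end.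

(* [Pr i] stands for the law given X_0 = i. *)
Definition mean_first_passage (R : realType) (d : measure_display)
    (Omega : measurableType d) (m : nat) (Pr : 'I_m -> probability Omega R)
    (X : nat -> Omega -> 'I_m) (T : nat -> Omega -> R) (i j : 'I_m) : \bar R :=
  (\int[Pr i]_w first_passage X T j w)%E.

(* \sum_j v_j m_ij *)
Definition passage_mixture (R : realType) (m : nat) (v : 'cV[R]_m)
    (mfp : 'I_m -> 'I_m -> \bar R) (i : 'I_m) : \bar R :=
  (\sum_(j < m) (v j 0)%:E * mfp i j)%E.

Definition is_ginverse (R : realType) (m : nat) (A G : 'M[R]_m) : Prop :=
  A *m G *m A = A.

Definition is_group_inverse (R : realType) (m : nat) (A G : 'M[R]_m) : Prop :=
  [/\ A *m G *m A = A, G *m A *m G = G & A *m G = G *m A].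

(* Main.v *)
(** Decompose T_n at the first visit to j: on the part of the sample space where
    j has not been visited during steps 1, ..., n, the Markov property gives the
    jump from X_n = k to X_(n+1) = l the weight [B^n]_(ik) mu_kl, where B is P with
    column j replaced by 0. Hence the matrix M of mean first passage times has
    j-th column sum_n B^n mu = (I - B)^-1 mu, i.e. m_ij = mu_i + sum_(k <> j) p_ik m_kj
    and, pairing with pi, pi_j m_jj = lambda. Consequently
    (I - P) M varpi = (I - P) mu, and the kernel of I - P consists of the constant
    vectors, which is the equivalence. When mu = lambda e, varpi = pi and
    N = M diag(pi) satisfies (I - P) N = lambda (Pi - P); multiplying by
    Z = (I - P + Pi)^-1 gives N - Pi N = lambda (I - Z), whose trace identifies the
    constant as lambda tr(Z). All other expressions reduce to tr(Z) through
    (I - Pi) G (I - Pi) = Z - Pi, valid for every g-inverse G of I - P. *)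

Require Import Defs.
From HB Require Import structures.
From mathcomp Require Import all_boot all_order all_algebra.
From mathcomp Require Import all_classical all_reals all_analysis.
From mathcomp Require Import measurable_realfun ring.

Set Implicit Arguments.
Unset Strict Implicit.
Unset Printing Implicit Defensive.

Import Order.TTheory GRing.Theory Num.Theory.
Import numFieldNormedType.Exports.

Local Open Scope classical_set_scope.
Local Open Scope ring_scope.

(** * Irreducible stochastic matrices *)

(** Transposing turns this into the row-vector criterion. The invertibility proofs below all start
    from a column vector in the kernel. *)
Lemma unitmx_col_inj (F : fieldType) (m : nat) (A : 'M[F]_m) :
  (forall x : 'cV_m, A *m x = 0 -> x = 0) -> A \in unitmx.
Proof.
move=> Ainj; rewrite -unitmx_tr -row_free_unit; apply: inj_row_free => v vA.
by apply: trmx_inj; rewrite trmx0; apply: Ainj; rewrite -[A]trmxK -trmx_mul vA trmx0.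
Qed.

Section stochastic.
Variables (R : realType) (m : nat) (P : 'M[R]_m).
Hypothesis P_ge0 : forall i j, 0 <= P i j.
Hypothesis P_ones : P *m ones R m = ones R m.
Hypothesis irr : irreducible_matrix P.

Lemma row_sum1 (A : 'M[R]_m) : A *m ones R m = ones R m ->
  forall i, \sum_j A i j = 1.
Proof.
move=> Ae i; move/matrixP/(_ i 0): Ae; rewrite !mxE => <-.
by apply: eq_bigr => j _; rewrite mxE mulr1.
Qed.

Lemma power_ge0 n i j : 0 <= (P ^+ n) i j.
Proof.
elim: n i j => [|n IH] i j; first by rewrite expr0 mxE ler0n.
by rewrite exprS mxE sumr_ge0// => k _; exact: mulr_ge0.
Qed.

Lemma power_fix n (x : 'cV[R]_m) : P *m x = x -> (P ^+ n) *m x = x.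
Proof.
move=> Px; elim: n => [|n IH]; first by rewrite expr0 mul1mx.
by rewrite exprSr -[LHS]mulmxA Px.
Qed.

Lemma power_fixl n (x : 'rV[R]_m) : x *m P = x -> x *m (P ^+ n) = x.
Proof.
move=> Px; elim: n => [|n IH]; first by rewrite expr0 mulmx1.
by rewrite exprS [LHS]mulmxA Px.
Qed.

(* x is maximal at i0 and x i0 is the P^n-average of x, so x k = x i0 whenever
   P^n charges k from i0. *)
Lemma harmonic_constant (x : 'cV[R]_m) : P *m x = x ->
  forall i j, x i 0 = x j 0.
Proof.
move=> Px i j.
have [i0 max0] : exists i0, forall k, x k 0 <= x i0 0.
  case: (@Order.TotalTheory.arg_maxP _ _ _ i xpredT (fun k => x k 0)) => // i0 _ h.
  by exists i0 => k; exact: h.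
suff h k : x k 0 = x i0 0 by rewrite !h.
have [n Pn_gt0] := irr i0 k.
have sum0 : \sum_l (P ^+ n) i0 l * (x i0 0 - x l 0) = 0.
  under eq_bigr do rewrite mulrBr.
  rewrite sumrB -mulr_suml (row_sum1 (power_fix n P_ones)) mul1r.
  by move/matrixP/(_ i0 0): (power_fix n Px); rewrite mxE => ->; rewrite subrr.
have := sum0; rewrite (bigD1 k)//= => /eqP; rewrite paddr_eq0; last first.
- by rewrite sumr_ge0// => l _; rewrite mulr_ge0 ?power_ge0// subr_ge0.
- by rewrite mulr_ge0 ?power_ge0// subr_ge0.
by rewrite mulf_eq0 (gt_eqF Pn_gt0)/= subr_eq0 => /andP[/eqP-> _].
Qed.

(** Some [q i] is positive, and for any [k] irreducibility gives [n] with [P ^+ n] charging [k] from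
    [i]; then [q = q P^n] bounds [q k] below by a positive term. *)
Lemma invariant_gt0 (q : 'rV[R]_m) : q *m P = q ->
  (forall i, 0 <= q 0 i) -> 0 < \sum_i q 0 i -> forall i, 0 < q 0 i.
Proof.
move=> qP q0 sq k.
have [i qi] : exists i, 0 < q 0 i.
  apply/not_existsP => nq; move: sq; rewrite big1 ?ltxx// => i _.
  by apply/eqP; rewrite eq_le q0 andbT leNgt; apply/negP/nq.
have [n Pn] := irr i k.
rewrite -(power_fixl n qP) mxE (bigD1 i)//= ltr_pwDl ?mulr_gt0//.
by rewrite sumr_ge0// => l _; rewrite mulr_ge0 ?power_ge0.
Qed.

(** No sign is assumed on [pi]. The triangle inequality gives [|pi| <= |pi| P] entrywise, and both
    sides have the same total since rows sum to 1, so [|pi|] is invariant. Hence [pi + |pi|] is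
    invariant, nonnegative and nonzero, so positive everywhere. *)
Lemma stationary_gt0 (pi : 'cV[R]_m) : stationary_vector P pi ->
  forall i, 0 < pi i 0.
Proof.
move=> [piP]; rewrite mxE => pi1.
have {}pi1 : \sum_i pi i 0 = 1.
  by rewrite -pi1; apply: eq_bigr => i _; rewrite !mxE mulr1.
have piE k : \sum_i pi i 0 * P i k = pi k 0.
  move/matrixP/(_ 0 k): piP; rewrite !mxE => <-.
  by apply: eq_bigr => i _; rewrite mxE.
have le_abs k : `|pi k 0| <= \sum_i `|pi i 0| * P i k.
  rewrite -[X in `|X|]piE (le_trans (ler_norm_sum _ _ _))//.
  by rewrite ler_sum// => i _; rewrite normrM (ger0_norm (P_ge0 _ _)).
have abs_sum : \sum_k (\sum_i `|pi i 0| * P i k - `|pi k 0|) = 0.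
  rewrite sumrB exchange_big/= -sumrB big1// => i _.
  by rewrite -mulr_sumr (row_sum1 P_ones) mulr1; exact: subrr.
have absE k : \sum_i `|pi i 0| * P i k = `|pi k 0|.
  have /eqP := abs_sum; rewrite psumr_eq0; last by move=> *; rewrite subr_ge0.
  by move=> /allP/(_ k (mem_index_enum k)); rewrite subr_eq0 => /eqP.
pose a : 'rV[R]_m := \row_i `|pi i 0|.
pose b : 'rV[R]_m := \row_i (pi i 0 + `|pi i 0|).
have a_ge : 1 <= \sum_i a 0 i.
  by rewrite -pi1 ler_sum// => i _; rewrite mxE ler_norm.
have b_gt0 : forall i, 0 < b 0 i.
  apply: invariant_gt0.
  - apply/rowP => k; rewrite !mxE -absE -[X in _ = X + _]piE -big_split/=.
    by apply: eq_bigr => i _; rewrite !mxE mulrDl.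
  - by move=> i; rewrite mxE -lerBlDl sub0r -normrN ler_norm.
  - under eq_bigr do rewrite mxE.
    rewrite big_split/= pi1 ltr_pwDl//; apply: (le_trans ler01).
    by apply: (le_trans a_ge); rewrite ler_sum// => i _; rewrite mxE.
(* A coordinate with [pi i <= 0] would make [pi i + |pi i|] vanish. *)
move=> i; have := b_gt0 i; rewrite mxE ltNge; apply: contraNT.
by rewrite -leNgt => pi_le0; rewrite ler0_norm// addrN.
Qed.

End stochastic.

(** * Transition matrices with a taboo state *)

(** The [(i, k)] entry of the [n]-th power is the probability of going from [i] to [k] in [n] steps
    with [j] avoided at steps 1 to [n]; the start itself may be [j]. *)
Definition taboo (R : realType) (m : nat) (P : 'M[R]_m) (j : 'I_m) : 'M[R]_m :=
  \matrix_(i, k) (if k == j then 0 else P i k).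

Section taboo.
Variables (R : realType) (m : nat) (P : 'M[R]_m) (pi : 'cV[R]_m).
Hypothesis P_ge0 : forall i j, 0 <= P i j.
Hypothesis P_ones : P *m ones R m = ones R m.
Hypothesis irr : irreducible_matrix P.
Hypothesis stat : stationary_vector P pi.

Lemma stationary_sum : \sum_i pi i 0 = 1.
Proof.
case: stat => _; rewrite mxE => <-.
by apply: eq_bigr => i _; rewrite !mxE mulr1.
Qed.

Lemma stationary_sum_mul (x : 'cV[R]_m) :
  \sum_i pi i 0 * (P *m x) i 0 = \sum_i pi i 0 * x i 0.
Proof.
case: stat => piP _; transitivity ((pi^T *m (P *m x)) 0 0).
  by rewrite [RHS]mxE; apply: eq_bigr => i _; rewrite [pi^T _ _]mxE.
by rewrite mulmxA piP mxE; apply: eq_bigr => i _; rewrite mxE.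
Qed.

Variable j : 'I_m.

Lemma taboo_mulmx (x : 'cV[R]_m) i :
  (taboo P j *m x) i 0 = (P *m x) i 0 - P i j * x j 0.
Proof.
rewrite !mxE (bigD1 j)//= [in RHS](bigD1 j)//= mxE eqxx mul0r add0r addrAC subrr add0r.
by apply: eq_bigr => k /negPf kj; rewrite mxE kj.
Qed.

Lemma taboo_ge0 i k : 0 <= taboo P j i k.
Proof. by rewrite mxE; case: ifP. Qed.

Lemma taboo_power_ge0 n i k : 0 <= (taboo P j ^+ n) i k.
Proof. exact: power_ge0 taboo_ge0 n i k. Qed.

Lemma stationary_sum_taboo (x : 'cV[R]_m) :
  \sum_i pi i 0 * (taboo P j *m x) i 0 = \sum_i pi i 0 * x i 0 - pi j 0 * x j 0.
Proof.
under eq_bigr do rewrite taboo_mulmx mulrBr.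
rewrite sumrB stationary_sum_mul; congr (_ - _).
under eq_bigr do rewrite mulrA.
rewrite -mulr_suml; congr (_ * _); case: stat => piP _.
move/matrixP/(_ 0 j): piP; rewrite !mxE => <-.
by apply: eq_bigr => i _; rewrite mxE.
Qed.

(* If x = taboo x then u = |x| <= taboo u; pairing with pi > 0 gives
   0 <= pi (taboo u - u) = - pi_j u_j, so u_j = 0 and u is harmonic. *)
Lemma taboo_unitmx : 1%:M - taboo P j \in unitmx.
Proof.
apply: unitmx_col_inj => x; rewrite mulmxBl mul1mx => /subr0_eq xE.
have pi_gt0 := stationary_gt0 P_ge0 P_ones irr stat.
pose u : 'cV[R]_m := \col_i `|x i 0|.
have u_le i : u i 0 <= (taboo P j *m u) i 0.
  rewrite [u i 0]mxE [leRHS]mxE {1}xE mxE (le_trans (ler_norm_sum _ _ _))//.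
  by rewrite ler_sum// => k _; rewrite normrM (ger0_norm (taboo_ge0 i k)) [u k 0]mxE.
have sumE : \sum_i pi i 0 * ((taboo P j *m u) i 0 - u i 0) = - (pi j 0 * u j 0).
  under eq_bigr do rewrite mulrBr.
  by rewrite sumrB stationary_sum_taboo addrC addKr.
have term_ge0 i : 0 <= pi i 0 * ((taboo P j *m u) i 0 - u i 0).
  by rewrite mulr_ge0 ?subr_ge0// ltW.
have uj0 : u j 0 = 0.
  have : 0 <= - (pi j 0 * u j 0) by rewrite -sumE sumr_ge0.
  rewrite oppr_ge0 pmulr_rle0// => uj_le0.
  by apply/eqP; rewrite eq_le uj_le0 mxE normr_ge0.
have tabooE i : (taboo P j *m u) i 0 = u i 0.
  move/eqP: sumE; rewrite uj0 mulr0 oppr0 psumr_eq0//.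
  move=> /allP/(_ i (mem_index_enum i)).
  by rewrite mulf_eq0 gt_eqF//= subr_eq0 => /eqP.
have Pu : P *m u = u.
  by apply/colP => i; rewrite -[RHS]tabooE taboo_mulmx uj0 mulr0 subr0.
apply/colP => i; rewrite mxE; apply/eqP; rewrite -normr_eq0.
by have := harmonic_constant P_ge0 P_ones irr Pu i j; rewrite uj0 mxE => ->.
Qed.

Lemma taboo_ones_le1 i : (taboo P j *m ones R m) i 0 <= 1.
Proof. by rewrite taboo_mulmx P_ones !mxE mulr1 gerBl. Qed.

Lemma taboo_power_ones_le1 n i : (taboo P j ^+ n *m ones R m) i 0 <= 1.
Proof.
elim: n i => [|n IH] i; first by rewrite expr0 mul1mx mxE.
rewrite exprS -[_ * _ *m _]mulmxA (le_trans _ (taboo_ones_le1 i))// mxE [leRHS]mxE.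
by rewrite ler_sum// => k _; rewrite ler_wpM2l ?taboo_ge0// [leRHS]mxE.
Qed.

(** Each [|y k|] is at most their sum and the powers are nonnegative, so the decay of the powers on
    any vector follows from that on [ones]. *)
Lemma taboo_power_bound n (y : 'cV[R]_m) i :
  `|(taboo P j ^+ n *m y) i 0| <=
  (\sum_k `|y k 0|) * (taboo P j ^+ n *m ones R m) i 0.
Proof.
rewrite mxE (le_trans (ler_norm_sum _ _ _))// [in leRHS]mxE mulr_sumr ler_sum// => k _.
rewrite normrM (ger0_norm (taboo_power_ge0 n i k)) mxE mulr1 mulrC.
by rewrite ler_wpM2r ?taboo_power_ge0// (bigD1 k)//= lerDl sumr_ge0.
Qed.

(** With [B = taboo P j] and [x = y - B y], the [n]-th term is [B^n y - B^(n+1) y]. *)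
Lemma taboo_telescope (x : 'cV[R]_m) N :
  let y := invmx (1%:M - taboo P j) *m x in
  \sum_(0 <= n < N) (taboo P j ^+ n *m x) = y - taboo P j ^+ N *m y.
Proof.
move=> y; have xE : x = y - taboo P j *m y.
  by rewrite -{1}[y]mul1mx -mulmxBl mulmxA mulmxV ?mul1mx// taboo_unitmx.
elim: N => [|N IH]; first by rewrite big_nil expr0 mul1mx subrr.
rewrite big_nat_recr//= IH {1}xE mulmxBr addrA subrK.
by rewrite exprSr -[_ * _ *m y]mulmxA.
Qed.

(** The terms are nonnegative and telescoping bounds their partial sums, so the series converges and
    its terms tend to 0. *)
Lemma taboo_power_ones_cvg0 i :
  (taboo P j ^+ n *m ones R m) i 0 @[n --> \oo] --> (0 : R).
Proof.
pose h n := (taboo P j ^+ n *m ones R m) i 0.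
have h_ge0 n : 0 <= h n.
  by rewrite /h mxE sumr_ge0// => k _; rewrite mulr_ge0 ?taboo_power_ge0// mxE.
apply: (@cvg_series_cvg_0 _ _ h); apply: nondecreasing_is_cvgn.
  by apply: nondecreasing_series => n _ _; exact: h_ge0.
pose y := invmx (1%:M - taboo P j) *m ones R m.
(* The remainder [B^N y] is at most the sum of the [|y k|], because [B^N] applied to [ones] stays
   below 1. *)
exists (y i 0 + \sum_k `|y k 0|) => _ [N _ <-].
have -> : series h N = y i 0 - (taboo P j ^+ N *m y) i 0.
  rewrite /series/= /h -summxE taboo_telescope//.
  by rewrite mxE [X in _ + X = _]mxE.
rewrite lerD2l (le_trans (ler_norm _))// normrN.
rewrite (le_trans (taboo_power_bound _ _ _))// ler_piMr ?sumr_ge0//.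
exact: taboo_power_ones_le1.
Qed.

Lemma taboo_series_cvg (x : 'cV[R]_m) i :
  \sum_(0 <= n < N) (taboo P j ^+ n *m x) i 0 @[N --> \oo] -->
  (invmx (1%:M - taboo P j) *m x) i 0.
Proof.
set y := invmx _ *m x.
have -> : (fun N => \sum_(0 <= n < N) (taboo P j ^+ n *m x) i 0) =
    (fun N => y i 0 - (taboo P j ^+ N *m y) i 0).
  by apply/funext => N; rewrite -summxE taboo_telescope mxE [X in _ + X = _]mxE.
rewrite -[X in _ --> X]subr0; apply: cvgB; first exact: cvg_cst.
apply/norm_cvg0P.
apply: (@squeeze_cvgr _ _ _ _ (cst 0)
  (fun n => (\sum_k `|y k 0|) * (taboo P j ^+ n *m ones R m) i 0)).
- by near=> n; rewrite normr_ge0 taboo_power_bound.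
- exact: cvg_cst.
- rewrite -[X in _ --> X](mulr0 (\sum_k `|y k 0|)).
  by apply: cvgM; [exact: cvg_cst | exact: taboo_power_ones_cvg0].
Unshelve. all: by end_near.
Qed.

End taboo.

(** * Generalized inverses and the mixture of passage times *)

Section group_inverse.
Variables (F : fieldType) (m : nat) (A : 'M[F]_m).

(** Commutation gives [AG = AHAG = HAGA = HA], and then [G = GAG = GAH = HAH = H]. *)
Lemma group_inverse_unique (G H : 'M[F]_m) :
  [/\ A *m G *m A = A, G *m A *m G = G & A *m G = G *m A] ->
  [/\ A *m H *m A = A, H *m A *m H = H & A *m H = H *m A] -> G = H.
Proof.
move=> [AGA GAG AG] [AHA HAH AH].
have AG_HA : A *m G = H *m A.
  have -> : A *m G = A *m H *m (A *m G) by rewrite mulmxA AHA.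
  by rewrite AH AG -mulmxA (mulmxA A) AGA.
by rewrite -GAG -mulmxA AG_HA -AH mulmxA -AG AG_HA.
Qed.
End group_inverse.

Section kemeny.
Variables (R : realType) (m : nat) (P M : 'M[R]_m) (pi mu : 'cV[R]_m).
Hypothesis P_ge0 : forall i j, 0 <= P i j.
Hypothesis P_ones : P *m ones R m = ones R m.
Hypothesis irr : irreducible_matrix P.
Hypothesis stat : stationary_vector P pi.
Local Notation e := (ones R m).
Local Notation A := (1%:M - P).
Local Notation Pi := (e *m pi^T).
Local Notation Z := (invmx (A + Pi)).

Lemma mulA_ones : A *m e = 0.
Proof. by rewrite mulmxBl mul1mx P_ones subrr. Qed.

Lemma stationary_mulA : pi^T *m A = 0.
Proof. by case: stat => piP _; rewrite mulmxBr mulmx1 piP subrr. Qed.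

Lemma stationary_ones : pi^T *m e = 1%:M.
Proof. by case: stat => _ pi1; rewrite [LHS]mx11_scalar pi1. Qed.

Lemma kerA (x : 'cV[R]_m) : A *m x = 0 -> exists c, x = c *: e.
Proof.
rewrite mulmxBl mul1mx => /subr0_eq/esym Px.
have xc := harmonic_constant P_ge0 P_ones irr Px.
(* Since [pi] sums to 1, the [pi]-average of a constant vector is its constant; this avoids choosing
   a state. *)
exists ((pi^T *m x) 0 0); apply/colP => i; rewrite !mxE mulr1.
transitivity (\sum_k pi k 0 * x i 0).
  by rewrite -mulr_suml (stationary_sum stat) mul1r.
by apply: eq_bigr => k _; rewrite mxE (xc i k).
Qed.

(** Applying [pi^T] to [(A + Pi) x = 0] leaves [pi^T x = 0]. Then [A x = 0], so [x = c e] with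
    [c = pi^T x = 0]. *)
Lemma fundamental_unitmx : A + Pi \in unitmx.
Proof.
apply: unitmx_col_inj => x Ex.
have pix : pi^T *m x = 0.
  move/(congr1 (mulmx pi^T)): Ex; rewrite mulmxDl mulmxDr !mulmxA.
  by rewrite stationary_mulA stationary_ones mul0mx add0r mul1mx mulmx0.
move: Ex; rewrite mulmxDl -(mulmxA e) pix mulmx0 addr0 => /kerA[c xE].
move: pix; rewrite xE -scalemxAr stationary_ones => /matrixP/(_ 0 0).
by rewrite !mxE mulr1 => ->; rewrite scale0r.
Qed.

Lemma fundamental_mul_ones : Z *m e = e.
Proof.
have AE : (A + Pi) *m e = e.
  by rewrite mulmxDl mulA_ones add0r -mulmxA stationary_ones mulmx1.
have {2}<- := AE.
by rewrite mulKmx ?fundamental_unitmx.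
Qed.

Lemma stationary_mul_fundamental : pi^T *m Z = pi^T.
Proof.
have piE : pi^T *m (A + Pi) = pi^T.
  by rewrite mulmxDr stationary_mulA add0r mulmxA stationary_ones mul1mx.
have {1}<- := piE.
by rewrite mulmxK ?fundamental_unitmx.
Qed.

Lemma fundamental_mulA : Z *m A = 1%:M - Pi.
Proof.
rewrite -{2}(addrK Pi A) mulmxBr mulVmx ?fundamental_unitmx//.
by rewrite mulmxA fundamental_mul_ones.
Qed.

Lemma mulA_fundamental : A *m Z = 1%:M - Pi.
Proof.
rewrite -{1}(addrK Pi A) mulmxBl mulmxV ?fundamental_unitmx//.
by rewrite -mulmxA stationary_mul_fundamental.
Qed.

Lemma Pi_idem : Pi *m Pi = Pi.
Proof. by rewrite mulmxA -(mulmxA e) stationary_ones mulmx1. Qed.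

Lemma mxtrace_Pi : \tr Pi = 1.
Proof. by rewrite mxtrace_mulC stationary_ones mxtrace1. Qed.

(* (1 - Pi) G (1 - Pi) = Z A G A Z = Z A Z = Z - Pi *)
Lemma ginverse_trace (G : 'M[R]_m) : is_ginverse A G ->
  1 + \tr G - \tr (G *m Pi) = \tr Z.
Proof.
move=> AGA; have : (1%:M - Pi) *m G *m (1%:M - Pi) = Z - Pi.
  rewrite -{1}fundamental_mulA -mulA_fundamental.
  have -> : Z *m A *m G *m (A *m Z) = Z *m (A *m G *m A) *m Z by rewrite !mulmxA.
  rewrite AGA fundamental_mulA mulmxBl mul1mx.
  by rewrite -mulmxA stationary_mul_fundamental.
move/(congr1 mxtrace); rewrite mxtrace_mulC (mulmxA (1%:M - Pi)).
have -> : (1%:M - Pi) *m (1%:M - Pi) = 1%:M - Pi.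
  by rewrite mulmxBl !mulmxBr !mul1mx mulmx1 Pi_idem subrr subr0.
rewrite mulmxBl mul1mx !raddfB/= (mxtrace_mulC Pi) mxtrace_Pi => /eqP.
by rewrite eq_sym subr_eq => /eqP->; rewrite [RHS]addrC addrA.
Qed.

Lemma group_inverse_fundamental : is_group_inverse A (Z - Pi).
Proof.
have PiA : Pi *m A = 0 by rewrite -mulmxA stationary_mulA mulmx0.
have APi : A *m Pi = 0 by rewrite mulmxA mulA_ones mul0mx.
have ZA : (Z - Pi) *m A = 1%:M - Pi by rewrite mulmxBl fundamental_mulA PiA subr0.
have AZ : A *m (Z - Pi) = 1%:M - Pi by rewrite mulmxBr mulA_fundamental APi subr0.
split.
- by rewrite AZ mulmxBl PiA subr0 mul1mx.
- rewrite ZA mulmxBl mul1mx mulmxBr -(mulmxA e) stationary_mul_fundamental.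
  by rewrite Pi_idem subrr subr0.
- by rewrite AZ ZA.
Qed.

(** A group inverse is a g-inverse, and [G = GAG = GGA] with [A e = 0] makes [G Pi] vanish. *)
Lemma group_inverse_trace (G : 'M[R]_m) : is_group_inverse A G ->
  1 + \tr G = \tr Z.
Proof.
move=> [AGA GAG AG]; rewrite -(ginverse_trace AGA).
rewrite (_ : G *m Pi = 0) ?mxtrace0 ?subr0//.
by rewrite -GAG -(mulmxA G) AG !mulmxA -!(mulmxA _ A) mulA_ones mulmx0 mul0mx.
Qed.

(** From [pi^T B = lambda u^T], a kernel vector of [B] satisfies [u^T x = 0], hence [A x = 0], hence
    [x = 0]. From [B e = lambda c e], [invmx B] maps [e] to a multiple of [e]; this makes it a
    g-inverse of [A] and gives its product with [Pi] the trace [1 / (lambda c)]. *)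
Lemma rank_one_inverse (lambda : R) (u : 'cV[R]_m) : lambda != 0 ->
  (u^T *m e) 0 0 != 0 ->
  let B := A + lambda *: e *m u^T in
  B \in unitmx /\
  lambda * \tr Z = lambda * (1 + \tr (invmx B)) - 1 / (u^T *m e) 0 0.
Proof.
move=> l0 ue0 B; set c := (u^T *m e) 0 0.
have ueE : u^T *m e = c%:M by rewrite [LHS]mx11_scalar.
have piB : pi^T *m B = lambda *: u^T.
  rewrite mulmxDr stationary_mulA add0r -scalemxAl -scalemxAr mulmxA.
  by rewrite stationary_ones mul1mx.
have Be : B *m e = (lambda * c) *: e.
  rewrite mulmxDl mulA_ones add0r -mulmxA ueE.
  by rewrite mul_mx_scalar scalerA mulrC.
have Bu : B \in unitmx.
  apply: unitmx_col_inj => x Bx.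
  have ux : u^T *m x = 0.
    move/(congr1 (mulmx pi^T)): Bx; rewrite mulmxA piB mulmx0 -scalemxAl.
    by move/eqP; rewrite scaler_eq0 (negPf l0) => /eqP.
  move: Bx; rewrite mulmxDl -(mulmxA _ u^T) ux mulmx0 addr0 => /kerA[b xE].
  move: ux; rewrite xE -scalemxAr ueE scale_scalar_mx => /matrixP/(_ 0 0).
  rewrite !mxE mulr1n => /eqP; rewrite mulf_eq0 (negPf ue0) orbF => /eqP->.
  by rewrite scale0r.
split=> //.
have Bie : invmx B *m e = (lambda * c)^-1 *: e.
  have lc0 : lambda * c != 0 by rewrite mulf_neq0.
  by rewrite -[e in LHS](scalerK lc0) -Be -scalemxAr mulKmx.
have gB : is_ginverse A (invmx B).
  have AE : A = B - lambda *: e *m u^T by rewrite addrK.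
  rewrite /is_ginverse {2}AE mulmxBr mulmxKV//.
  rewrite -!scalemxAl -scalemxAr -mulmxA (mulmxA (invmx B)) Bie -scalemxAl.
  by rewrite -scalemxAr mulmxA mulA_ones mul0mx !scaler0 subr0.
rewrite -(ginverse_trace gB) mulmxA Bie -scalemxAl linearZ/= mxtrace_Pi mulr1.
by rewrite mulrBr invfM mulrA divff// !mul1r.
Qed.

(** * First-step equations for mean passage times and their mixtures *)

Hypothesis ME : forall i j, M i j = mu i 0 + (P *m M) i j - P i j * M j j.
Local Notation lambda := ((pi^T *m mu) 0 0).

(** Pair column [j] of [ME] with [pi]: by invariance the sums of [pi i * M i j] cancel, leaving
    [lambda - pi j * M j j = 0]. *)
Lemma stationary_mean_return j : pi j 0 * M j j = lambda.
Proof.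
have lE : lambda = \sum_i pi i 0 * mu i 0.
  by rewrite mxE; apply: eq_bigr => i _; rewrite mxE.
have : \sum_i pi i 0 * M i j =
    \sum_i pi i 0 * (mu i 0 + (P *m col j M) i 0 - P i j * M j j).
  apply: eq_bigr => i _; rewrite [X in _ * X]ME; congr (_ * (_ + _ - _)).
  by rewrite !mxE; apply: eq_bigr => k _; rewrite mxE.
under [RHS]eq_bigr do rewrite mulrBr mulrDr mulrA.
rewrite sumrB big_split/= -lE (stationary_sum_mul stat) -mulr_suml.
have -> : \sum_i pi i 0 * P i j = pi j 0.
  case: stat => piP _; move/matrixP/(_ 0 j): piP; rewrite !mxE => <-.
  by apply: eq_bigr => i _; rewrite mxE.
have -> : \sum_i pi i 0 * (col j M) i 0 = \sum_i pi i 0 * M i j.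
  by apply: eq_bigr => i _; rewrite mxE.
move=> /eqP; rewrite addrAC -[X in X == _]add0r (inj_eq (addIr _)).
by rewrite eq_sym subr_eq0 => /eqP->.
Qed.

Hypothesis lambda_gt0 : 0 < lambda.
Local Notation varpi := (\col_j (pi j 0 * mu j 0 / lambda)).

Lemma mean_return_mul_varpi j : M j j * varpi j 0 = mu j 0.
Proof.
rewrite mxE -(stationary_mean_return j).
have pi_gt0 := stationary_gt0 P_ge0 P_ones irr stat j.
have : pi j 0 * M j j != 0 by rewrite stationary_mean_return gt_eqF.
rewrite mulf_eq0 negb_or => /andP[p0 M0].
by field; rewrite p0 M0.
Qed.

(** Weight the equations [ME] by [v j] and sum over [j]; the total weight 1 leaves [mu] unscaled. *)
Lemma mulA_mixture (v : 'cV[R]_m) : \sum_j v j 0 = 1 ->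
  A *m (M *m v) = mu - P *m (\col_j (M j j * v j 0)).
Proof.
move=> v1; rewrite mulmxBl mul1mx mulmxA; apply/colP => i.
transitivity (\sum_j (M i j - (P *m M) i j) * v j 0).
  by rewrite mxE [(M *m v) i 0]mxE [X in _ + X]mxE [(P *m M *m v) i 0]mxE -sumrB;
    apply: eq_bigr => j _; rewrite mulrBl.
rewrite [RHS]mxE [X in _ = _ + X]mxE [X in _ - X]mxE -[mu i 0]mulr1 -v1 mulr_sumr.
rewrite -sumrB; apply: eq_bigr => j _.
by rewrite [M i j]ME [(\col_j _) j 0]mxE; ring.
Qed.

(** For [varpi] the correction vector in [mulA_mixture] is [mu] itself, so [A M varpi = A mu], and
    constancy of a vector means lying in the kernel of [A]. *)
Lemma mixture_constant_iff :
  (forall i i', (M *m varpi) i 0 = (M *m varpi) i' 0) <->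
  (forall j j', mu j 0 = mu j' 0).
Proof.
have v1 : \sum_j varpi j 0 = 1.
  under eq_bigr do rewrite mxE.
  rewrite -mulr_suml (_ : \sum_i _ = lambda) ?divff ?gt_eqF//.
  by rewrite [RHS]mxE; apply: eq_bigr => i _; rewrite [in RHS]mxE.
have := mulA_mixture v1.
have -> : \col_j (M j j * varpi j 0) = mu.
  by apply/colP => j; rewrite mxE mean_return_mul_varpi.
have -> : mu - P *m mu = A *m mu by rewrite mulmxBl mul1mx.
move=> AE.
have cst_ker (x : 'cV[R]_m) : (forall i i', x i 0 = x i' 0) <-> A *m x = 0.
  split=> [xc|/kerA[c ->] i i']; last by rewrite !mxE.
  apply/colP => i; have -> : x = x i 0 *: e.
    by apply/colP => k; rewrite !mxE mulr1.
  by rewrite -scalemxAr mulA_ones scaler0.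
by rewrite !cst_ker AE.
Qed.

Lemma mean_sojourn_constant : (forall j j', mu j 0 = mu j' 0) -> mu = lambda *: e.
Proof.
move=> muc; apply/colP => i; rewrite !mxE mulr1.
rewrite -[LHS]mul1r -(stationary_sum stat) mulr_suml; apply: eq_bigr => k _.
by rewrite mxE (muc i k).
Qed.

Lemma kemeny_constant : mu = lambda *: e -> M *m pi = (lambda * \tr Z) *: e.
Proof.
move=> muE; pose N : 'M[R]_m := \matrix_(i, j) (M i j * pi j 0).
have Ne : N *m e = M *m pi.
  by apply/colP => i; rewrite !mxE; apply: eq_bigr => j _; rewrite !mxE mulr1.
have AN : A *m N = lambda *: (Pi - P).
  rewrite mulmxBl mul1mx; apply/matrixP => i j.
  have piM := stationary_mean_return j.
  (* Making [lambda] opaque keeps [mxE] from expanding the product that defines it. *)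
  set l := lambda in muE piM *; clearbody l.
  have PN : (P *m N) i j = (P *m M) i j * pi j 0.
    by rewrite !mxE mulr_suml; apply: eq_bigr => k _; rewrite mxE mulrA.
  rewrite mxE [X in _ + X]mxE PN [N i j]mxE ME muE !mxE big_ord1 !mxE -piM.
  by ring.
have [K KE] : exists K, M *m pi = K *: e.
  apply: kerA; rewrite -Ne mulmxA AN -scalemxAl mulmxBl -mulmxA stationary_ones.
  by rewrite mulmx1 P_ones subrr scaler0.
rewrite KE; congr (_ *: e).
have : Z *m (A *m N) = lambda *: (1%:M - Z).
  rewrite AN -scalemxAr; congr (_ *: _); rewrite mulmxBr mulmxA fundamental_mul_ones.
  have -> : Z *m P = Z - (1%:M - Pi).
    by rewrite -fundamental_mulA mulmxBr mulmx1 subKr.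
  by rewrite opprB addrA (addrC Pi) subrK.
(* Take traces in [N - Pi N = lambda (1 - Z)]: the diagonal of [N] is constantly [lambda], and the
   trace of [Pi N] equals that of [N e pi^T = K Pi], which is [K]. *)
rewrite mulmxA fundamental_mulA mulmxBl mul1mx => /(congr1 mxtrace).
rewrite mxtraceZ !raddfB/= mxtrace1 mxtrace_mulC mulmxA Ne KE.
rewrite -scalemxAl mxtraceZ mxtrace_Pi mulr1.
have -> : \tr N = lambda * m%:R.
  rewrite /mxtrace; under eq_bigr do rewrite mxE mulrC stationary_mean_return.
  by rewrite sumr_const card_ord mulr_natr.
by rewrite mulrBr => /addrI/oppr_inj.
Qed.

End kemeny.

(** * Markov renewal processes *)

Section integral_aux.
Local Open Scope ereal_scope.
Context d (Omega : measurableType d) (R : realType).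

(** The complement of [D] is null for [nu], and the two measures agree on measurable subsets of
    [D]. *)
Lemma ge0_integral_restr (mu nu : {measure set Omega -> \bar R}) (D : set Omega)
    (f : Omega -> \bar R) : measurable D ->
  (forall A, measurable A -> nu A = mu (A `&` D)) ->
  measurable_fun setT f -> (forall x, 0 <= f x) ->
  \int[nu]_x f x = \int[mu]_(x in D) f x.
Proof.
move=> mD nuE mf f0; rewrite -(setUv D) ge0_integral_setU//=.
- rewrite [X in _ + X]null_set_integral ?adde0//.
  + by apply: eq_measure_integral => A mA AD; rewrite nuE// setIidl.
  + exact: measurableC.
  + exact: measurable_funTS.
  + by rewrite /= nuE ?setICl ?measure0//; exact: measurableC.
- exact: measurableC.
- exact: measurable_funTS.
- exact/disj_setPCl.
Qed.

Context (m : nat) (Y : Omega -> 'I_m).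
Hypothesis mY : forall k, measurable (Y @^-1` [set k]).

Lemma fiber_bigcup (A : set Omega) :
  A = \big[setU/set0]_(k < m) (A `&` [set w | Y w = k]).
Proof.
rewrite -bigcup_seq; apply/seteqP; split=> [w Aw|w [k _ []]//].
by exists (Y w); rewrite //= mem_index_enum.
Qed.

Lemma fiber_trivIset (A : set Omega) (D : set 'I_m) :
  trivIset D (fun k => A `&` [set w | Y w = k]).
Proof. by move=> k l _ _ [w [[_ <-] [_ <-]]]. Qed.

Lemma fiber_probability (P : probability Omega R) (A : set Omega) :
  measurable A -> P A = \sum_(k < m) P (A `&` [set w | Y w = k]).
Proof.
move=> mA; rewrite {1}[A]fiber_bigcup measure_bigsetU_ord//.
  by move=> k; apply: measurableI => //; exact: mY.
exact: fiber_trivIset.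
Qed.

Lemma fiber_integral (mu : {measure set Omega -> \bar R}) (A : set Omega)
    (f : Omega -> \bar R) :
  measurable A -> measurable_fun setT f -> (forall w, 0 <= f w) ->
  \int[mu]_(w in A) f w =
  \sum_(k < m) \int[mu]_(w in A `&` [set w | Y w = k]) f w.
Proof.
move=> mA mf f0; rewrite {1}[A]fiber_bigcup ge0_integral_bigsetU//.
- by move=> k; apply: measurableI => //; exact: mY.
- exact: index_enum_uniq.
- exact: fiber_trivIset.
- exact: measurable_funTS.
Qed.

End integral_aux.

(** * Events of the past and avoidance of a state *)

Section past.
Context d (Omega : measurableType d) (R : realType) (m : nat).
Variables (X : nat -> Omega -> 'I_m) (T : nat -> Omega -> R).
Hypothesis mX : forall n i, measurable (X n @^-1` [set i]).
Hypothesis mT : forall n, measurable_fun setT (T n).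

Lemma pastI n (A B : set Omega) :
  past X T n A -> past X T n B -> past X T n (A `&` B).
Proof. exact: (@measurableI _ (g_sigma_algebraType _)). Qed.

Lemma pastC n (A : set Omega) : past X T n A -> past X T n (~` A).
Proof. exact: sigma_algebraC. Qed.

Lemma pastT n : past X T n setT.
Proof. exact: (@measurableT _ (g_sigma_algebraType _)). Qed.

Lemma past_state n k i : (k <= n)%N -> past X T n (X k @^-1` [set i]).
Proof. by move=> kn; apply: sub_sigma_algebra; exists k => //; left; exists i. Qed.

Lemma past_measurable n A : past X T n A -> measurable A.
Proof.
apply: smallest_sub; first exact: sigma_algebra_measurable.
move=> _ [k _ [[i ->]|[C mC ->]]]; first exact: mX.
by rewrite -[X in measurable X]setTI; exact: mT.
Qed.

Lemma past_incl n A : past X T n A -> past X T n.+1 A.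
Proof.
apply: smallest_sub; first exact: smallest_sigma_algebra.
move=> B [k kn kB]; apply: sub_sigma_algebra; exists k => //.
exact: leq_trans kn (leqnSn n).
Qed.

(** Step 0 is left out, so that a start in [j] leads to the return time. *)
Definition avoid (j : 'I_m) (n : nat) : set Omega :=
  [set w | forall r, (0 < r <= n)%N -> X r w <> j].

Lemma avoid0 j : avoid j 0 = setT.
Proof. by apply/seteqP; split=> w //= _ [|r] /andP[]. Qed.

Lemma avoidS j n : avoid j n.+1 = avoid j n `&` ~` (X n.+1 @^-1` [set j]).
Proof.
apply/seteqP; split=> w /=.
  move=> av; split; last by apply: av; rewrite leqnn.
  by move=> r /andP[r0 rn]; apply: av; rewrite r0 leqW.
move=> [av avn] r /andP[r0]; rewrite leq_eqVlt => /predU1P[-> //|rn].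
by apply: av; rewrite r0.
Qed.

Lemma avoid_past j n : past X T n (avoid j n).
Proof.
elim: n => [|n IH]; first by rewrite avoid0; exact: pastT.
by rewrite avoidS; apply: pastI; [exact: past_incl | apply: pastC; exact: past_state].
Qed.

End past.
Arguments pastT {d Omega R m} X T n.
Arguments avoid_past {d Omega R m} X T j n.

(** * Law and mean of a sojourn on a prescribed jump *)

Section jumps.
Context d (Omega : measurableType d) (R : realType) (m : nat).
Variables (Pr : probability Omega R) (Q : 'I_m -> 'I_m -> cumulative R R).
Variables (X : nat -> Omega -> 'I_m) (T : nat -> Omega -> R).
Hypothesis mrp : markov_renewal_process Pr Q X T.

Let mX : forall n i, measurable (X n @^-1` [set i]) := mrp_measurable_state mrp.
Let mT : forall n, measurable_fun setT (T n) := mrp_measurable_time mrp.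

Definition sojourn n w : R := T n.+1 w - T n w.

Lemma measurable_sojourn n : measurable_fun setT (sojourn n).
Proof. exact: measurable_funB. Qed.

Lemma sojourn_ge0 n w : 0 <= sojourn n w.
Proof. by rewrite subr_ge0 (mrp_time_nondecreasing mrp). Qed.

Variables (n : nat) (A : set Omega).
Hypothesis pA : past X T n A.
Let mA : measurable A := past_measurable mX mT pA.
Variables k l : 'I_m.

Let D := A `&` [set w | X n w = k] `&` [set w | X n.+1 w = l].
Let p := Pr (A `&` [set w | X n w = k]).

Lemma jump_measurable : measurable D.
Proof. by apply: measurableI; [apply: measurableI => // |]; exact: mX. Qed.

Lemma jump_cdf t : Pr (D `&` [set w | sojourn n w <= t]) = (p * (Q k l t)%:E)%E.
Proof.
rewrite /p -(mrp_markov mrp pA); congr (Pr _).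
by apply/seteqP; split=> w /= => [[[[]]]|[? []]].
Qed.

Lemma measurable_sojourn_le t : measurable [set w | sojourn n w <= t].
Proof.
have := measurable_sojourn n measurableT (measurable_itv `]-oo, t]).
by rewrite setTI; congr measurable; apply/seteqP; split=> w; rewrite /= in_itv.
Qed.

Lemma jump_itv a b : a <= b ->
  Pr (D `&` [set w | a < sojourn n w <= b]) = (p * (Q k l b - Q k l a)%:E)%E.
Proof.
move=> ab; have -> : D `&` [set w | a < sojourn n w <= b] =
    (D `&` [set w | sojourn n w <= b]) `\` (D `&` [set w | sojourn n w <= a]).
  apply/seteqP; split=> w /=; first by
    move=> [Dw /andP[aw wb]]; split=> // -[_]; rewrite leNgt aw.
  move=> [[Dw wb] na]; split=> //; rewrite wb andbT ltNge; apply/negP => wa.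
  exact: na.
have mI t : measurable (D `&` [set w | sojourn n w <= t]).
  by apply: measurableI; [exact: jump_measurable | exact: measurable_sojourn_le].
have DI : D `&` [set w | sojourn n w <= b] `&` (D `&` [set w | sojourn n w <= a]) =
    D `&` [set w | sojourn n w <= a].
  apply/setIidr => w [Dw wa]; split=> //=; exact: le_trans ab.
transitivity (Pr (D `&` [set w | (sojourn n w <= b)%R]) -
              Pr (D `&` [set w | (sojourn n w <= a)%R]))%E.
  by rewrite measureD ?DI// -ge0_fin_numE// fin_num_measure.
rewrite !jump_cdf EFinB muleBr// fin_num_measure//.
by apply: measurableI => //; exact: mX.
Qed.

(** The witness is the image under the sojourn of [Pr] restricted to [D]. Sojourns are nonnegative,
    so the preimage of the half-line is the whole space. *)
Lemma jump_law : exists nu : {measure set (measurableTypeR R) -> \bar R},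
  (forall B, measurable B -> nu B = Pr (D `&` sojourn n @^-1` B)) /\
  (\int[nu]_(t in `[0%R, +oo[) t%:E = \int[Pr]_(w in D) (sojourn n w)%:E)%E.
Proof.
have mD := jump_measurable; have mS := measurable_sojourn n.
pose PrD : {measure set Omega -> \bar R} := mrestr Pr mD.
pose nu : {measure set (measurableTypeR R) -> \bar R} :=
  pushforward PrD (sojourn n : Omega -> measurableTypeR R).
exists (nu mS); split=> [B mB|]; first by rewrite /= /pushforward/= /mrestr setIC.
have sE : sojourn n @^-1` `[0%R, +oo[ = setT.
  by apply/seteqP; split=> w //= _; rewrite in_itv/= sojourn_ge0.
rewrite ge0_integral_pushforward//=.
  rewrite sE; apply: ge0_integral_restr => //.
  - exact/measurable_EFinP.
  - by move=> w; rewrite lee_fin sojourn_ge0.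
by move=> t; rewrite inE/= in_itv/= andbT lee_fin.
Qed.

(** Divided by [p], the law of the sojourn on [D] agrees with the Stieltjes measure of [Q k l] on
    half-open intervals, hence on all measurable sets. *)
Lemma jump_integral :
  (\int[Pr]_(w in D) (sojourn n w)%:E = p * mean_jump_time Q k l)%E.
Proof.
have mD := jump_measurable.
have mS := measurable_sojourn n.
have mp : measurable (A `&` [set w | X n w = k]) by apply: measurableI => //; exact: mX.
(* The mean may be infinite here; for [p = 0] the convention that 0 times [+oo] is 0 matches the
   integral over the null set [D]. *)
have [p0|p_neq0] := eqVneq p 0%E.
  rewrite p0 mul0e null_set_integral//; first exact/measurable_EFinP/measurable_funTS.
  apply/eqP; rewrite eq_le measure_ge0 andbT -p0.
  by apply: le_measure; rewrite ?inE//; apply: subIsetl.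
have [r r_gt0 pE] : exists2 r, 0 < r & p = r%:E.
  have pfin : p \is a fin_num by rewrite fin_num_measure.
  by exists (fine p); rewrite ?fineK// fine_gt0// lt0e p_neq0 measure_ge0/= ltey_eq pfin.
have [nu [nuE <-]] := jump_law.
(* The law of the sojourn on D has the increments of r Q_kl, hence the factor 1/r. *)
have q_ge0 : 0 <= r^-1 by rewrite invr_ge0 ltW.
pose q : {nonneg R} := NngNum q_ge0.
have LSE : forall B, measurable B -> lebesgue_stieltjes_measure (Q k l) B = mscale q nu B.
  apply: lebesgue_stieltjes_measure_unique => I [[a b]]/= _ <-.
  rewrite /lebesgue_stieltjes_measure /measure_extension/=.
  rewrite measurable_mu_extE/=; last exact: is_ocitv.
  have [ab|ba] := leP a b; last first.
    by rewrite set_itv_ge ?wlength0 ?measure0// bnd_simp -leNgt ltW.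
  rewrite wlength_itv_bnd// /mscale/= nuE; last exact: measurable_itv.
  have -> : D `&` sojourn n @^-1` `]a, b] = D `&` [set w | a < sojourn n w <= b].
    by apply/seteqP; split=> w /=; rewrite in_itv.
  by rewrite jump_itv// pE muleA -EFinM mulVf ?mul1r// gt_eqF.
have -> : mean_jump_time Q k l = (\int[mscale q nu]_(t in `[0%R, +oo[) t%:E)%E.
  by apply: eq_measure_integral => B mB _; exact: LSE.
rewrite ge0_integral_mscale//=.
  by rewrite muleA pE -EFinM divff ?mul1e// gt_eqF.
by move=> t; rewrite /= in_itv/= andbT lee_fin.
Qed.

End jumps.

(** * The first passage time as a series of sojourns *)

Section first_passage_series.
Context d (Omega : measurableType d) (R : realType) (m : nat).
Variables (X : nat -> Omega -> 'I_m) (T : nat -> Omega -> R).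
Hypothesis T0 : forall w, T 0%N w = 0.
Hypothesis T_nd : forall n w, T n w <= T n.+1 w.

(** If [N] is the first visit, [avoid X j n] holds exactly for [n < N], and those sojourns telescope
    to [T N]. The last term supplies [+oo] when there is no visit. *)
Lemma first_passage_series j w :
  (first_passage X T j w =
   \sum_(0 <= n <oo) ((fun w => (sojourn T n w)%:E) \_ (avoid X j n)) w +
   (cst +oo \_ (\bigcap_n avoid X j n)) w)%E.
Proof.
have term_ge0 n : (0 <= ((fun w => (sojourn T n w)%:E) \_ (avoid X j n)) w)%E.
  by apply: erestrict_ge0 => ? _; rewrite lee_fin subr_ge0.
rewrite /first_passage; case: pselect => [visit|novisit]; last first.
  rewrite [X in (_ + X)%E]patchE mem_set ?addey//.
    by rewrite gt_eqF// (lt_le_trans ltNy0)// nneseries_ge0.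
  by move=> n _ r /andP[r0 _] Xj; apply: novisit; exists r; rewrite r0 Xj eqxx.
case: ex_minnP => N /andP[N0 /eqP XN] Nmin.
rewrite [X in (_ + X)%E]patchE memNset ?adde0; last first.
  by move=> /(_ N I N); rewrite N0 leqnn => /(_ isT).
have term n : ((fun w => (sojourn T n w)%:E) \_ (avoid X j n)) w =
    (if (n < N)%N then sojourn T n w else 0)%:E.
  rewrite patchE; have [nN|Nn] := ltnP n N.
    rewrite mem_set// => r /andP[r0 rn] Xr.
    by have := Nmin r; rewrite r0 Xr eqxx => /(_ isT); rewrite leqNgt (leq_ltn_trans rn).
  by rewrite memNset// => /(_ N); rewrite N0 Nn => /(_ isT).
(* The partial sums are constant from [N] on. *)
apply/esym/lim_near_cst => //; near=> K.
have NK : (N <= K)%N by near: K; exists N.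
rewrite (eq_bigr _ (fun n _ => term n)) sumEFin; congr (_%:E).
rewrite (big_cat_nat (n := N))//= [X in _ + X](_ : _ = 0) ?addr0; last first.
  by rewrite big_nat big1// => n /andP[Nn _]; rewrite ltnNge Nn.
rewrite big_nat (eq_bigr (fun n => T n.+1 w - T n w)); last by move=> n /andP[_ ->].
by rewrite -big_nat telescope_sumr// T0 subr0.
Unshelve. all: by end_near.
Qed.

End first_passage_series.

(** * Transition probabilities and mean first passage times *)

Section mean_first_passage.
Context d (Omega : measurableType d) (R : realType) (m : nat).
Variables (Pr : 'I_m -> probability Omega R) (Q : 'I_m -> 'I_m -> cumulative R R).
Variables (X : nat -> Omega -> 'I_m) (T : nat -> Omega -> R).
Hypothesis mrp : forall i, markov_renewal_process (Pr i) Q X T.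
Hypothesis start : forall i, Pr i (X 0%N @^-1` [set i]) = 1%E.
Local Notation P := (embedded_matrix Q).

Let mX (i : 'I_m) : forall n k, measurable (X n @^-1` [set k]) :=
  mrp_measurable_state (mrp i).
Let mT (i : 'I_m) : forall n, measurable_fun setT (T n) := mrp_measurable_time (mrp i).

Lemma kernel_cdf k l t :
  Pr k (X 0%N @^-1` [set k] `&` [set w | X 1%N w = l] `&`
        [set w | sojourn T 0 w <= t]) = (Q k l t)%:E.
Proof.
have := jump_cdf (mrp k) (pastT X T 0) k l t.
by rewrite setTI (start k : Pr k [set w | X 0%N w = k] = _) mul1e.
Qed.

(** The [lim] in [embedded_matrix] is meaningful only once convergence is known: [Q k l] is
    nondecreasing, and bounded by 1 as a probability under [Pr k]. *)
Lemma kernel_cvg k l : Q k l t @[t --> +oo] --> P k l.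
Proof.
rewrite mxE; apply/cvgP/nondecreasing_cvgr.
  exact: cumulative_is_nondecreasing.
exists 1 => _ [t _ <-]; rewrite -lee_fin -kernel_cdf probability_le1//.
have := jump_measurable (mrp k) (pastT X T 0) k l; rewrite setTI => mD.
by apply: measurableI => //; exact: (measurable_sojourn_le (mrp k)).
Qed.

(** Let [t] tend to infinity along the integers in the Markov property; the events [F N] increase to
    [D]. *)
Lemma transition i n A k l : past X T n A ->
  Pr i (A `&` [set w | X n w = k] `&` [set w | X n.+1 w = l]) =
  (Pr i (A `&` [set w | X n w = k]) * (P k l)%:E)%E.
Proof.
move=> pA; have mA := past_measurable (mX i) (mT i) pA.
set p := Pr i (A `&` [set w | X n w = k]); set D := _ `&` _ `&` _.
have mD : measurable D := jump_measurable (mrp i) pA k l.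
have mp : measurable (A `&` [set w | X n w = k]).
  by apply: measurableI => //; exact: (mX i).
pose F (N : nat) := D `&` [set w | sojourn T n w <= N%:R].
have FE : \bigcup_N F N = D.
  apply/seteqP; split=> [w [N _ []]//|w Dw].
  exists (Num.truncn (sojourn T n w)).+1 => //; split=> //=.
  by rewrite ltW// Num.Theory.truncnS_gt.
have mF N : measurable (F N).
  by apply: measurableI => //; exact: (measurable_sojourn_le (mrp i)).
have : (Pr i \o F) N @[N --> \oo] --> Pr i D.
  rewrite -[X in _ --> Pr i X]FE; apply: nondecreasing_cvg_mu => //; first by rewrite FE.
  move=> a b ab; apply/subsetPset => w [Dw wa]; split=> //=.
  by rewrite (le_trans wa)// ler_nat.
have -> : Pr i \o F = fun N => (p * (Q k l N%:R)%:E)%E.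
  by apply/funext => N /=; rewrite (jump_cdf (mrp i) pA).
move/cvg_unique; apply => //; apply: cvgeZl; first by rewrite fin_num_measure.
apply: cvg_EFin; first by near=> N.
exact: (cvg_comp _ _ (@cvgr_idn R) (@kernel_cvg k l)).
Unshelve. all: by end_near.
Qed.

Lemma start_law i k : Pr i [set w | X 0%N w = k] = (i == k)%:R%:E.
Proof.
have [<-|ik] := eqVneq i k; first exact: start.
rewrite /= mulr0n; apply/eqP; rewrite eq_le measure_ge0 andbT.
have mi : measurable [set w | X 0%N w = i] := mX i 0%N i.
have <- : Pr i (~` [set w | X 0%N w = i]) = 0%:E.
  by rewrite probability_setC// (start i : Pr i [set w | X 0%N w = i] = _) subee.
apply: le_measure; rewrite ?inE//.
- exact: (mX i).
- exact: measurableC.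
- by move=> w /= -> ki; rewrite ki eqxx in ik.
Qed.

Lemma transition_start k l :
  Pr k ([set w | X 0%N w = k] `&` [set w | X 1%N w = l]) = (P k l)%:E.
Proof.
have := transition k k l (pastT X T 0).
by rewrite setTI => ->; rewrite start_law eqxx mul1e.
Qed.

Lemma embedded_ge0 k l : 0 <= P k l.
Proof. by rewrite -lee_fin -transition_start measure_ge0. Qed.

Lemma embedded_ones : P *m ones R m = ones R m.
Proof.
apply/colP => k; rewrite [RHS]mxE mxE; apply: EFin_inj.
rewrite -sumEFin; under eq_bigr do rewrite [ones R m _ _]mxE mulr1 -transition_start.
rewrite -(fiber_probability (mX k 1%N)); first by rewrite start_law eqxx.
exact: (mX k 0%N k).
Qed.

(** Induction on [n]. For [k = j] both sides vanish; otherwise ending in [k] already avoids [j] at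
    the last step, and splitting on [X n] yields the matrix product. *)
Lemma avoid_law i j n k :
  Pr i (avoid X j n `&` [set w | X n w = k]) = ((taboo P j ^+ n) i k)%:E.
Proof.
elim: n k => [|n IH] k; first by rewrite avoid0 setTI start_law expr0 mxE.
rewrite avoidS exprSr mxE.
have [->|kj] := eqVneq k j.
  rewrite big1 => [|l _]; last by rewrite mxE eqxx mulr0.
  rewrite (_ : _ `&` _ = set0) ?measure0//.
  by apply/seteqP; split=> w //= -[[_ nXj]].
have -> : avoid X j n `&` ~` (X n.+1 @^-1` [set j]) `&` [set w | X n.+1 w = k] =
    avoid X j n `&` [set w | X n.+1 w = k].
  apply/seteqP; split=> w /= => [[[]]//|[av Xk]]; do 2 split=> //.
  by rewrite Xk => /eqP; apply/negP.
have pa : past X T n (avoid X j n) := avoid_past X T j n.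
have ma := past_measurable (mX i) (mT i) pa.
rewrite (fiber_probability (mX i n)) -?sumEFin; last first.
  by apply: measurableI => //; exact: (mX i).
apply: eq_bigr => l _; rewrite setIAC transition// IH -EFinM; congr (_ * _)%:E.
by rewrite [RHS]mxE (negPf kj).
Qed.

Lemma avoid_measure i j n : Pr i (avoid X j n) = ((taboo P j ^+ n *m ones R m) i 0)%:E.
Proof.
have ma := past_measurable (mX i) (mT i) (avoid_past X T j n).
rewrite (fiber_probability (mX i n))// mxE -sumEFin.
by apply: eq_bigr => k _; rewrite avoid_law mxE mulr1.
Qed.

Hypothesis finite_mu : forall k l, (mean_jump_time Q k l < +oo)%E.

Lemma mean_jump_time_fin k l : (fine (mean_jump_time Q k l))%:E = mean_jump_time Q k l.
Proof.
rewrite fineK// ge0_fin_numE//; apply: integral_ge0 => t.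
by rewrite /= in_itv/= andbT lee_fin.
Qed.

(** Split on [X n = k] and [X n.+1 = l], then apply [jump_integral] with [avoid X j n] as the event
    of the past. *)
Lemma avoid_integral i j n :
  (\int[Pr i]_(w in avoid X j n) (sojourn T n w)%:E =
   ((taboo P j ^+ n *m mean_sojourn Q) i 0)%:E)%E.
Proof.
have pa : past X T n (avoid X j n) := avoid_past X T j n.
have ma := past_measurable (mX i) (mT i) pa.
have mS : measurable_fun setT (fun w => (sojourn T n w)%:E).
  exact/measurable_EFinP/(measurable_sojourn (mrp i)).
have S0 w : (0 <= (sojourn T n w)%:E)%E by rewrite lee_fin (sojourn_ge0 (mrp i)).
rewrite (fiber_integral (mX i n))// mxE -sumEFin; apply: eq_bigr => k _.
rewrite (fiber_integral (mX i n.+1))//; last by apply: measurableI => //; exact: (mX i).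
rewrite [mean_sojourn Q k 0]mxE EFinM -sumEFin ge0_sume_distrr; last first.
  move=> l _; rewrite mean_jump_time_fin; apply: integral_ge0 => t.
  by rewrite /= in_itv/= andbT lee_fin.
apply: eq_bigr => l _.
by rewrite (jump_integral (mrp i) pa) avoid_law mean_jump_time_fin.
Qed.

Hypothesis irr : irreducible_matrix P.
Variable pi : 'cV[R]_m.
Hypothesis stat : stationary_vector P pi.

(** The event lies in every [avoid X j n], whose probabilities tend to 0. *)
Lemma never_visit0 i j : Pr i (\bigcap_n avoid X j n) = 0%E.
Proof.
have ma n := past_measurable (mX i) (mT i) (avoid_past X T j n).
have mn : measurable (\bigcap_n avoid X j n) by exact: bigcapT_measurable.
apply/eqP; rewrite eq_le measure_ge0 andbT -[leLHS]fineK ?fin_num_measure// lee_fin.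
apply: (cvgr_to_ge (@taboo_power_ones_cvg0 _ _ _ _ embedded_ge0 embedded_ones irr stat j i)).
near=> n; rewrite -lee_fin fineK ?fin_num_measure// -avoid_measure.
by apply: le_measure; rewrite ?inE//; exact: bigcap_inf.
Unshelve. all: by end_near.
Qed.

Lemma mean_first_passageE i j : mean_first_passage Pr X T i j =
  ((invmx (1%:M - taboo P j) *m mean_sojourn Q) i 0)%:E.
Proof.
have ma n := past_measurable (mX i) (mT i) (avoid_past X T j n).
have mn : measurable (\bigcap_n avoid X j n) by exact: bigcapT_measurable.
rewrite /mean_first_passage.
under eq_integral do rewrite (first_passage_series X (mrp_time0 (mrp i))
  (mrp_time_nondecreasing (mrp i))).
have term_ge0 n w : (0 <= ((fun w => (sojourn T n w)%:E) \_ (avoid X j n)) w)%E.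
  by apply: erestrict_ge0 => ? _; rewrite lee_fin (sojourn_ge0 (mrp i)).
have mterm n : measurable_fun setT ((fun w => (sojourn T n w)%:E) \_ (avoid X j n)).
  apply/(measurable_restrictT _ _).1 => //.
  exact/measurable_EFinP/measurable_funTS/(measurable_sojourn (mrp i)).
rewrite ge0_integralD//=; last 4 first.
- by move=> w _; apply: nneseries_ge0 => n _ _.
- exact: ge0_emeasurable_sum.
- by move=> w _; apply: erestrict_ge0 => ? _; exact: le0y.
- by apply/(measurable_restrictT _ _).1.
(* The value [+oo] is taken on a null set only, so it contributes 0. *)
rewrite [X in (_ + X)%E](_ : _ = 0%E) ?adde0; last first.
  by rewrite -integral_mkcond null_set_integral//; exact: never_visit0.
rewrite integral_nneseries//.
under eq_eseriesr do rewrite -integral_mkcond avoid_integral.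
apply: cvg_lim => //; under eq_fun do rewrite sumEFin.
apply: cvg_EFin; first by near=> n.
exact: (taboo_series_cvg embedded_ge0 embedded_ones irr stat).
Unshelve. all: by end_near.
Qed.

End mean_first_passage.

Section passage_matrix.
Variables (R : realType) (m : nat) (P : 'M[R]_m) (mu : 'cV[R]_m).

Definition passage_matrix : 'M[R]_m :=
  \matrix_(i, j) (invmx (1%:M - taboo P j) *m mu) i 0.

(** Column [j] is sent to [mu] by [1 - taboo P j], and [taboo_mulmx] rewrites the taboo product as
    the [P] product minus its term at [j]. *)
Lemma passage_matrixE : (forall j, 1%:M - taboo P j \in unitmx) ->
  forall i j, passage_matrix i j =
    mu i 0 + (P *m passage_matrix) i j - P i j * passage_matrix j j.
Proof.
move=> unit i j; rewrite -addrA.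
have colE : col j passage_matrix = invmx (1%:M - taboo P j) *m mu.
  by apply/colP => k; rewrite !mxE.
have colI k : passage_matrix k j = col j passage_matrix k 0 by rewrite [RHS]mxE.
have -> : (P *m passage_matrix) i j = (P *m col j passage_matrix) i 0.
  by rewrite !mxE; apply: eq_bigr => k _; rewrite colI.
rewrite !colI -taboo_mulmx.
have : (1%:M - taboo P j) *m col j passage_matrix = mu by rewrite colE mulKVmx.
by rewrite mulmxBl mul1mx => <-; rewrite [X in _ = X + _]mxE [X in _ = _ + X + _]mxE subrK.
Qed.

End passage_matrix.

Lemma passage_mixtureE (R : realType) (m : nat) (v : 'cV[R]_m) (M : 'M[R]_m)
    (mfp : 'I_m -> 'I_m -> \bar R) : (forall i j, mfp i j = (M i j)%:E) ->
  forall i, passage_mixture v mfp i = ((M *m v) i 0)%:E.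
Proof.
move=> mfpE i; rewrite /passage_mixture mxE -sumEFin.
by apply: eq_bigr => j _; rewrite mfpE -EFinM mulrC.
Qed.

Theorem corollary2p1 (R : realType) (d : measure_display)
    (Omega : measurableType d) (m : nat)
    (Pr : 'I_m -> probability Omega R) (Q : 'I_m -> 'I_m -> cumulative R R)
    (X : nat -> Omega -> 'I_m) (T : nat -> Omega -> R) (pi : 'cV[R]_m)
    (mrp : forall i, markov_renewal_process (Pr i) Q X T)
    (start : forall i, Pr i (X 0%N @^-1` [set i]) = 1%E)
    (irr : irreducible_matrix (embedded_matrix Q))
    (finite_mu : forall i j, (mean_jump_time Q i j < +oo)%E)
    (stat : stationary_vector (embedded_matrix Q) pi)
    (lambda_gt0 : 0 < (pi^T *m mean_sojourn Q) 0 0) :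
  let A := 1%:M - embedded_matrix Q in
  let e := ones R m in
  let Pi := e *m pi^T in
  let mu := mean_sojourn Q in
  let lambda := (pi^T *m mu) 0 0 in
  let varpi := \col_j (pi j 0 * mu j 0 / lambda) in
  let mfp := mean_first_passage Pr X T in
  let k1 := passage_mixture pi mfp in
  let k2 := passage_mixture varpi mfp in
  ((forall i i', k2 i = k2 i') <-> (forall j j', mu j 0 = mu j' 0)) /\
  ((forall j j', mu j 0 = mu j' 0) ->
    mu = lambda *: e /\
    exists K : R,
      (forall i, k2 i = K%:E) /\
      (forall G, is_ginverse A G ->
         K = lambda * (1 + \tr G - \tr (G *m Pi))) /\
      (A + Pi \in unitmx /\ K = lambda * \tr (invmx (A + Pi))) /\
      ((exists! Ash, is_group_inverse A Ash) /\
       (forall Ash, is_group_inverse A Ash -> K = lambda * (1 + \tr Ash))) /\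
      (forall u : 'cV[R]_m, (u^T *m e) 0 0 != 0 ->
         A + mu *m u^T \in unitmx /\
         K = lambda * (1 + \tr (invmx (A + mu *m u^T)))
             - 1 / (u^T *m e) 0 0) /\
      (forall i, k1 i = K%:E)).
Proof.
have P_ge0 := embedded_ge0 mrp start.
have P_ones := embedded_ones mrp start.
set P := embedded_matrix Q in irr stat P_ge0 P_ones *.
move=> A e Pi mu lambda varpi mfp k1 k2.
pose M := passage_matrix P mu.
have ME := passage_matrixE mu (taboo_unitmx P_ge0 P_ones irr stat).
have mfpE i j : mfp i j = (M i j)%:E.
  by rewrite /mfp (mean_first_passageE mrp start finite_mu irr stat) [M i j]mxE.
have mixE := passage_mixtureE _ mfpE.
have lambda_neq0 : lambda != 0 by rewrite gt_eqF.
split.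
  rewrite -(mixture_constant_iff P_ge0 P_ones irr stat ME lambda_gt0).
  split=> k2c i i'; first by apply: EFin_inj; rewrite -!mixE; exact: k2c.
  by rewrite /k2 !mixE; congr (_%:E); exact: k2c.
move=> /(mean_sojourn_constant stat) muE; split=> //.
have KE := kemeny_constant P_ge0 P_ones irr stat ME muE.
(* Equal sojourn means make the two weight vectors coincide, so [k1] and [k2] share one
   computation. *)
have varpiE : varpi = pi.
  have muj j : mu j 0 = lambda by rewrite {1}muE mxE [e j 0]mxE mulr1.
  by apply/colP => j; rewrite mxE muj mulfK.
have k1E i : k1 i = (lambda * \tr (invmx (A + Pi)))%:E.
  by rewrite /k1 mixE KE mxE [ones R m i 0]mxE mulr1.
exists (lambda * \tr (invmx (A + Pi))); split.
  by move=> i; rewrite /k2 varpiE; exact: k1E.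
split; first by move=> G AG; rewrite (ginverse_trace P_ge0 P_ones irr stat AG).
split; first by split=> //; exact: fundamental_unitmx.
split.
  split=> [|G AG]; last by rewrite (group_inverse_trace P_ge0 P_ones irr stat AG).
  have gA := group_inverse_fundamental P_ge0 P_ones irr stat.
  by exists (invmx (A + Pi) - Pi); split=> // G; exact: group_inverse_unique.
(* With [mu = lambda e] the perturbation has the form treated in [rank_one_inverse]. *)
split=> // u ue; rewrite muE.
by have := rank_one_inverse P_ge0 P_ones irr stat lambda_neq0 ue.
Qed.
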